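(* Let $A = \{a_k\}_{k=1}^\infty$ be a strictly increasing sequence of non-negative real numbers, and let $S$ be a subset of $A$ (viewed as a set). Suppose there exists a positive integer $r$ such that (i) $a_k > a_{k-1} + a_{k-r}$ for all $k\ge r+1$; (ii) for some $n\in\mathbb{N}$, the set $A$ does not contain any sum-dominant subset $T$ with $|T|\le 2r+n$; and (iii) $|S| = 2r+n+\ell$ for some $\ell\in\mathbb{N}$ (with the same $r$ and $n$). Then: (1) $S$ is not sum-dominant, and $|S-S|-|S+S|\ge \ell(n+1)$. (2) Let $m\in\mathbb{N}$ and let $b_1,\ldots,b_m$ be integers. If $m|S|+\frac{m(m+1)}{2}\le \ell(n+1)$, then $S^* = S\cup\{b_1,\ldots,b_m\}$ is not sum-dominant.
   Context: $\mathbb{N}$ denotes the set of nonnegative integers. For a finite set $X$ of real numbers, define $X+X=\{x+x'\mid x,x'\in X\}$ and $X-X=\{x-x'\mid x,x'\in X\}$. The set $X$ is called sum-dominant if $|X+X|>|X-X|$. *)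

(* Defs.v *)
From mathcomp Require Import all_boot all_order all_algebra.
From mathcomp Require Import finmap.
From mathcomp Require Import boolp classical_sets reals.

Set Implicit Arguments.
Unset Strict Implicit.
Unset Printing Implicit Defensive.

Import Order.TTheory GRing.Theory Num.Theory.

Local Open Scope fset_scope.
Local Open Scope ring_scope.

Definition sumset (R : realType) (X : {fset R}) : {fset R} :=
  [fset x + y | x in X, y in X].

Definition diffset (R : realType) (X : {fset R}) : {fset R} :=
  [fset x - y | x in X, y in X].

Definition sum_dominant (R : realType) (X : {fset R}) : bool :=
  (#|` diffset X| < #|` sumset X|)%N.

(* Sequences (a_k)_{k >= 1} are indexed from 1: the value [a 0] is never
   constrained and does not belong to the set of terms. *)
Definition terms (R : realType) (a : nat -> R) : set R :=
  [set x | exists2 k : nat, (1 <= k)%N & x = a k].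

(* Main.v *)
Require Import Defs.
From mathcomp Require Import all_boot all_order all_algebra.
From mathcomp Require Import finmap.
From mathcomp Require Import boolp classical_sets reals.
From mathcomp Require Import zify lra.

Set Implicit Arguments.
Unset Strict Implicit.
Unset Printing Implicit Defensive.

Import Order.TTheory GRing.Theory Num.Theory.

Local Open Scope fset_scope.
Local Open Scope ring_scope.

(** The excess of differences over sums grows each time a large enough set of
    terms receives a new maximum.  Let [x = a k] be the maximum of a set [S] of [K] terms, where
    [K >= 2r + n + 1], and let [T] be [S] without [x].

    - At most [K] sums are new, namely those of the form [x + y]
      ([card_sumset_add]).
    - At most [r - 1] elements of [T] exceed [a (k - r)], because such an element
      is one of [a (k - r + 1), ..., a (k - 1)] ([card_terms_between]).  Each of
      the remaining elements [y], at least [K - r] in number, gives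
      [x - y >= x - a (k - r) > a (k - 1)], which is larger than any difference of
      [T], because terms are nonnegative.  So [x - y] and [y - x] are both new,
      which makes at least [2 (K - r)] new differences ([card_diffset_add]).

    Hence the excess increases by at least [2 (K - r) - K = K - 2r >= n + 1].
    Removing the maximum [l] times from [S] leaves a set of [2r + n] terms, whose
    excess is nonnegative by hypothesis, so the excess of [S] is at least
    [l (n + 1)] ([sumset_diffset_gap]).

    Adding [m] further numbers creates at most
    [m |S| + m (m + 1) / 2] sums and destroys no difference
    ([card_sumset_union]); the excess of [S] absorbs that many sums. *)

(** * Sumsets and difference sets under adding elements *)

Section FiniteSets.
Variable R : realType.
Implicit Types (x y z : R) (X Y S B L T : {fset R}).

Lemma sumsetP X z :
  reflect (exists x y, [/\ x \in X, y \in X & z = x + y]) (z \in sumset X).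
Proof.
apply: (iffP (imfset2P _ _ _ _ _)) => [[x xX [y yX ->]]|[x [y [xX yX ->]]]].
  by exists x, y.
by exists x => //; exists y.
Qed.

Lemma diffsetP X z :
  reflect (exists x y, [/\ x \in X, y \in X & z = x - y]) (z \in diffset X).
Proof.
apply: (iffP (imfset2P _ _ _ _ _)) => [[x xX [y yX ->]]|[x [y [xX yX ->]]]].
  by exists x, y.
by exists x => //; exists y.
Qed.

Lemma diffsetS X Y : X `<=` Y -> diffset X `<=` diffset Y.
Proof.
move=> /fsubsetP XY; apply/fsubsetP => z /diffsetP [x [y [xX yX ->]]].
by apply/diffsetP; exists x, y; split=> //; apply: XY.
Qed.

Lemma card_sumset_add x X :
  (#|` sumset (x |` X)| <= #|` sumset X| + #|` X|.+1)%N.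
Proof.
have sub : sumset (x |` X) `<=` sumset X `|` [fset x + y | y in x |` X].
  apply/fsubsetP => z /sumsetP [u [v [uX vX ->]]]; rewrite inE; apply/orP.
  have [->|ux] := eqVneq u x; first by right; apply: in_imfset.
  have [->|vx] := eqVneq v x; first by right; rewrite addrC; apply: in_imfset.
  left; apply/sumsetP; exists u, v; move: uX vX.
  by rewrite !inE (negbTE ux) (negbTE vx).
apply: leq_trans (fsubset_leq_card sub) _.
apply: leq_trans (leq_card_fsetU _ _) _.
rewrite leq_add2l; apply: leq_trans (leq_imfset_card _ _ _) _.
by rewrite cardfsU1; case: (_ \notin _).
Qed.

(** Inserting the elements of [B] one at a time, the [i]-th insertion costs at
    most [|S| + i] sums; the triangular number is the sum of the [i]. *)
Lemma card_sumset_union S B :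
  (#|` sumset (S `|` B)|
    <= #|` sumset S| + (#|` B| * #|` S| + (#|` B| * (#|` B| + 1)) %/ 2))%N.
Proof.
have [k] := ubnP #|` B|; elim: k B => // k IH B Bk.
have [->|/fset0Pn [b bB]] := eqVneq B fset0.
  by rewrite fsetU0 leq_addr.
pose C := B `\ b.
have cB : #|` B| = #|` C|.+1 by rewrite (cardfsD1 b) bB.
have -> : S `|` B = b |` (S `|` C) by rewrite fsetUCA fsetD1K.
have {}IH := IH C; rewrite cB in Bk *.
have {}IH := IH Bk.
have step := card_sumset_add b (S `|` C).
have [cU _] := leq_card_fsetU S C.
have -> : (#|` C|.+1 * (#|` C|.+1 + 1) %/ 2
            = #|` C| * (#|` C| + 1) %/ 2 + #|` C|.+1)%N.
  by rewrite [RHS]addnC -divnMDl //; congr (_ %/ 2)%N; lia.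
rewrite mulSn; lia.
Qed.

(** The negatives of the new differences are new as well; this symmetry is what
    makes differences outnumber sums, each [y] giving two differences
    but only one sum. *)
Lemma card_diffset_add x T L : L `<=` T ->
  (forall t t' y, t \in T -> t' \in T -> y \in L -> t - t' < x - y) ->
  (#|` diffset T| + 2 * #|` L| <= #|` diffset (x |` T)|)%N.
Proof.
move=> /fsubsetP LT far.
pose P := [fset x - y | y in L]; pose N := [fset y - x | y in L].
have cP : #|` P| = #|` L| by rewrite card_imfset // => u v /addrI /oppr_inj.
have cN : #|` N| = #|` L| by rewrite card_imfset // => u v /addIr.
have disjPN : [disjoint P & N]%fset.
  apply/fdisjointP => z /imfsetP [/= y yL ->].
  apply/negP => /imfsetP [/= y' y'L e].
  have := far _ _ _ (LT _ yL) (LT _ yL) yL.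
  have := far _ _ _ (LT _ yL) (LT _ yL) y'L.
  lra.
have disjT : [disjoint diffset T & P `|` N]%fset.
  apply/fdisjointP => z /diffsetP [t [t' [tT t'T ->]]]; rewrite inE.
  apply/norP; split; apply/negP => /imfsetP [/= y yL e].
    by have := far _ _ _ tT t'T yL; rewrite e ltxx.
  by have := far _ _ _ t'T tT yL; lra.
have -> : (2 * #|` L| = #|` P `|` N|)%N.
  by move: disjPN; rewrite -leq_card_fsetU => /eqP ->; rewrite cP cN mul2n addnn.
move: disjT; rewrite -leq_card_fsetU => /eqP <-.
apply/fsubset_leq_card/fsubsetP => z; rewrite !inE.
move=> /or3P [/diffsetP [t [t' [tT t'T ->]]]|/imfsetP [/= y yL ->]|
             /imfsetP [/= y yL ->]]; apply/diffsetP.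
- by exists t, t'; split=> //; apply: fset1Ur.
- by exists x, y; rewrite !inE ?eqxx ?(LT _ yL) ?orbT.
- by exists y, x; split=> //; rewrite !inE ?eqxx ?(LT _ yL) ?orbT.
Qed.

Lemma fset_max_exists X : (0 < #|` X|)%N ->
  exists2 x, x \in X & forall y, y \in X -> y <= x.
Proof.
rewrite cardfs_gt0 => /fset0Pn [x0 x0X].
have [y _ ymax] := @arg_maxP _ R X [` x0X] xpredT val isT.
exists (val y) => [|z zX]; first exact: valP.
exact: (ymax [` zX]).
Qed.

End FiniteSets.

(** * Sets of terms of a rapidly growing sequence *)

Section Terms.
Variables (R : realType) (a : nat -> R).

Lemma card_terms_between (X : {fset R}) (i k : nat) :
  (forall y, y \in X -> exists2 j, (i < j < k)%N & y = a j) ->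
  (#|` X| <= k - i.+1)%N.
Proof.
move=> Xa; rewrite -[leqRHS](size_iota i.+1) -(size_map a).
apply: uniq_leq_size => [|y /Xa [j ij ->]]; first exact: fset_uniq.
by apply: map_f; rewrite mem_iota; lia.
Qed.

Hypothesis a_incr : forall j k : nat, (1 <= j)%N -> (j < k)%N -> a j < a k.

Lemma terms_le i j : (1 <= i)%N -> (1 <= j)%N -> (a i <= a j) = (i <= j)%N.
Proof.
move=> i1 j1; case: (ltngtP i j) => [ij|ji|->]; last exact: lexx.
  exact/ltW/a_incr.
by apply/negbTE; rewrite -ltNge a_incr.
Qed.

Hypothesis a_ge0 : forall k : nat, (1 <= k)%N -> 0 <= a k.

Variable r : nat.
Hypothesis r_gt0 : (0 < r)%N.
Hypothesis a_growth : forall k : nat, (r + 1 <= k)%N ->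
  a k > a (k - 1)%N + a (k - r)%N.

(** The smallest [|T| - (r - 1)] elements of [T] are far below the new maximum
    [a k], so each of them contributes two new differences. *)
Lemma card_diffset_add_term (T : {fset R}) (k : nat) :
  (forall y, y \in T -> exists2 j, (0 < j < k)%N & y = a j) ->
  (r <= #|` T|)%N ->
  (#|` diffset T| + 2 * (#|` T| - r.-1) <= #|` diffset (a k |` T)|)%N.
Proof.
move=> Ta rT.
have rk : (r + 1 <= k)%N by have := card_terms_between Ta; lia.
pose L := [fset y in T | y <= a (k - r)%N].
have LT : L `<=` T by apply/fsubsetP => y; rewrite !inE => /andP[].
have cTL : (#|` T `\` L| <= r.-1)%N.
  have -> : r.-1 = (k - (k - r).+1)%N by lia.
  apply: card_terms_between => y; rewrite !inE => /andP[+ yT].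
  rewrite yT /=; have [j jk ->] := Ta y yT.
  by rewrite terms_le ?ltnNge; [exists j => // | |]; lia.
have cL : (#|` T| - r.-1 <= #|` L|)%N.
  by move: cTL; rewrite cardfsDS //; lia.
apply: leq_trans (card_diffset_add (x := a k) LT _).
  by rewrite leq_add2l leq_mul2l.
move=> t t' y /Ta [i ik ->] /Ta [j jk ->]; rewrite !inE => /andP[_ yk].
have : a i <= a (k - 1)%N by rewrite terms_le; lia.
have : 0 <= a j by apply: a_ge0; lia.
have := a_growth rk; lra.
Qed.

(** Each induction step removes the maximum [x] of [S]: only then are all other
    elements terms of smaller index than [x], so that the differences lost with
    [x] outnumber the lost sums by at least [n + 1]. *)
Lemma sumset_diffset_gap (n l : nat) (S : {fset R}) :
  (forall T : {fset R}, ([set` T] `<=` terms a)%classic ->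
     (#|` T| <= 2 * r + n)%N -> ~~ sum_dominant T) ->
  ([set` S] `<=` terms a)%classic ->
  #|` S| = (2 * r + n + l)%N ->
  (#|` sumset S| + l * (n + 1) <= #|` diffset S|)%N.
Proof.
move=> no_sd; elim: l S => [|l IH] S Sa cS.
  by have := no_sd S Sa; rewrite cS addn0 leqnn -leqNgt addn0; apply.
have [x xS xmax] : exists2 x, x \in S & forall y, y \in S -> y <= x.
  by apply: fset_max_exists; lia.
have [k k1 xk] := Sa x xS.
pose T := S `\ x.
have TS y : y \in T -> y \in S by rewrite !inE => /andP[].
have cT : #|` T| = (2 * r + n + l)%N.
  by move: cS; rewrite (cardfsD1 x) xS -/T; lia.
have Ta : ([set` T] `<=` terms a)%classic by move=> y /TS; exact: Sa.
have Tk y : y \in T -> exists2 j, (0 < j < k)%N & y = a j.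
  move=> yT; have [j j1 yj] := Ta y yT; exists j => //.
  have yx : y != x by move: yT; rewrite !inE => /andP[].
  rewrite j1 ltn_neqAle -(terms_le j1 k1) -yj -xk xmax ?TS // andbT.
  by apply: contraNneq yx => jk; rewrite yj xk jk.
have := card_diffset_add_term Tk; have := card_sumset_add x T.
rewrite -xk fsetD1K // cT => sums diffs.
have := IH T Ta cT; lia.
Qed.

End Terms.

Theorem theorem3 (R : realType) (a : nat -> R) (S : {fset R}) (r n l : nat)
  (a_ge0 : forall k : nat, (1 <= k)%N -> 0 <= a k)
  (a_incr : forall j k : nat, (1 <= j)%N -> (j < k)%N -> a j < a k)
  (S_sub : ([set` S] `<=` terms a)%classic)
  (r_gt0 : (0 < r)%N)
  (a_growth : forall k : nat, (r + 1 <= k)%N ->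
     a k > a (k - 1)%N + a (k - r)%N)
  (no_small_sd : forall T : {fset R}, ([set` T] `<=` terms a)%classic ->
     (#|` T| <= 2 * r + n)%N -> ~~ sum_dominant T)
  (card_S : #|` S| = (2 * r + n + l)%N) :
  (~~ sum_dominant S /\
     (#|` diffset S|%:Z - #|` sumset S|%:Z >= (l * (n + 1))%N%:Z)) /\
  (forall (m : nat) (b : 'I_m -> int),
     (m * #|` S| + (m * (m + 1)) %/ 2 <= l * (n + 1))%N ->
     ~~ sum_dominant (S `|` [fset (b i)%:~R | i in 'I_m])).
Proof.
have gap := sumset_diffset_gap a_incr a_ge0 r_gt0 a_growth no_small_sd S_sub
  card_S.
split; first by split; [rewrite /sum_dominant|]; lia.
move=> m b small; rewrite /sum_dominant -leqNgt.
set B := [fset _ | _ in _].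
have Bm : (#|` B| <= m)%N.
  by apply: leq_trans (leq_imfset_card _ _ _) _; rewrite size_enum_ord.
apply: leq_trans (card_sumset_union S B) _.
apply: leq_trans (fsubset_leq_card (diffsetS (fsubsetUl S B))).
apply: leq_trans gap; rewrite leq_add2l; apply: leq_trans small.
by rewrite leq_add ?leq_mul2r ?Bm ?orbT // leq_div2r // leq_mul ?leq_add2r.
Qed.
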